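(* Let $G$ be a finitely generated group. If $G$ is exact, then for every $n\ge 1$, every bounded left Banach $G$-module $X$ and every weak-* closed Hopf $G$-module $\mathcal{E}\subseteq\mathcal{L}(X,\ell_\infty(G))$, we have $H^n_b(G,\mathcal{E})=0$.
   Context: $G$ is a discrete group generated by a finite symmetric set $S=S^{-1}$. All Banach spaces are over $\mathbb{R}$. Write $C=\ell_\infty(G)$ with the supremum norm $\|\cdot\|_C$, $1_G\in C$ for the constant function $1$, and let $G$ act on $C$ by $(g*f)(h)=f(g^{-1}h)$. For a function $f:G\to C$ write $f_g=f(g)\in C$. The uniform convolution algebra $\ell_u(G)$ is the completion of the space of finitely supported functions $f:G\to C$ in the norm $\|f\|_u=\big\|\sum_{g\in G}|f_g|\big\|_C$; its elements are regarded as functions $\xi:G\to C$. $G$ acts on $\ell_u(G)$ by isometries by $(g\star\xi)_h=g*\xi_{g^{-1}h}$. Exactness: $G$ is exact if for every $\varepsilon>0$ there is $\xi\in\ell_u(G)$ such that (a) $\xi_g=0$ for all but finitely many $g\in G$; (b) $\xi_g\ge 0$ for all $g\in G$ and $\sum_{g\in G}\xi_g=1_G$; (c) $\|\xi-s\star\xi\|_u\le\varepsilon$ for every $s\in S$. A bounded left Banach $G$-module is a Banach space $X$ with a homomorphism $\Phi$ from $G$ to the invertible bounded linear operators on $X$ with $\sup_{g}\|\Phi(g)\|<\infty$; write $gx=\Phi(g)x$. $\mathcal{L}(X,C)$ is the Banach space of bounded linear operators $X\to C$. It is a bounded left Banach $G$-module by $(g\cdot T)(x)=g*(T(g^{-1}x))$,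 and a $C$-module by $(aT)(x)=a\,T(x)$ for $a\in C$ (product in $C$). It is isometrically isomorphic to $\ell_\infty(G,X^* )$ via $T\mapsto(g\mapsto(x\mapsto T(x)(g)))$, hence is the dual of $\ell_1(G,X)$; the weak-* topology on $\mathcal{L}(X,C)$ is the one coming from this predual. A Hopf $G$-module $\mathcal{E}\subseteq\mathcal{L}(X,C)$ is a subspace that is both a $G$-submodule for the $G$-action $(g\cdot T)(x)=g*(T(g^{-1}x))$ and a $C$-submodule for the $C$-action $(aT)(x)=a\,T(x)$; weak-* closed means closed in the weak-* topology of $\mathcal{L}(X,C)$. $H^n_b(G,\mathcal{E})$ is the bounded cohomology of $G$ with coefficients in $\mathcal{E}$: the degree-$n$ cohomology of the complex of bounded functions $G^n\to\mathcal{E}$, $n\ge 0$, with the differential $(db)(g_1,\dots,g_{n+1})=g_1 b(g_2,\dots,g_{n+1})+\sum_{i=1}^{n}(-1)^i b(g_1,\dots,g_ig_{i+1},\dots,g_{n+1})+(-1)^{n+1}b(g_1,\dots,g_n)$. *)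

(* Defs.v *)
From HB Require Import structures.
From mathcomp Require Import all_boot all_order all_algebra.
From mathcomp Require Import finmap.
From mathcomp Require Import all_classical all_reals all_analysis.
Set Implicit Arguments.
Unset Strict Implicit.
Unset Printing Implicit Defensive.
Import Order.TTheory GRing.Theory Num.Theory.
Import numFieldNormedType.Exports.
Local Open Scope classical_set_scope.
Local Open Scope ring_scope.

Section EllInf.
Context (R : realType) (G : groupType).

Definition bounded_pred : {pred G -> R} :=
  [pred f | `[< exists M : R, forall g, `|f g| <= M >]].

Lemma bounded_predP (f : G -> R) :
  reflect (exists M : R, forall g, `|f g| <= M) (f \in bounded_pred).
Proof. by rewrite inE; exact: asboolP. Qed.

Lemma bounded_pred_submod : submod_closed bounded_pred.
Proof.
split; first by apply/bounded_predP; exists 0 => g; rewrite normr0.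
move=> a u v /bounded_predP[M uM] /bounded_predP[N vN].
apply/bounded_predP; exists (`|a| * M + N) => g.
rewrite (le_trans (ler_normD _ _))// lerD// normrM.
by rewrite ler_wpM2l.
Qed.

HB.instance Definition _ :=
  GRing.isSubmodClosed.Build R (G -> R) bounded_pred bounded_pred_submod.

Record ellinf := Ellinf { ellinf_fun :> G -> R; _ : ellinf_fun \in bounded_pred }.

HB.instance Definition _ := [isSub for ellinf_fun].
HB.instance Definition _ := [Choice of ellinf by <:].
HB.instance Definition _ := [SubChoice_isSubLmodule of ellinf by <:].

Lemma ellinfP (f h : ellinf) : f =1 h -> f = h.
Proof. by move=> fh; apply/val_inj/funext. Qed.

Lemma ellinf_linE (a : R) (f u : ellinf) g : (a *: f + u) g = a * f g + u g.
Proof. by []. Qed.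

Lemma ellinf_bounded (f : ellinf) : exists M : R, forall g, `|f g| <= M.
Proof. by apply/bounded_predP; case: f. Qed.

Definition ellinf_norm (f : ellinf) : R := sup (range (fun g => `|f g|)).

Lemma ellinf_has_sup (f : ellinf) : has_sup (range (fun g => `|f g|)).
Proof.
split; first by exists `|f 1%g|; exists 1%g.
by have [M fM] := ellinf_bounded f; exists M => _ [g _ <-].
Qed.

Lemma ellinf_norm_ge (f : ellinf) g : `|f g| <= ellinf_norm f.
Proof. by apply: (ub_le_sup (ellinf_has_sup f).2); exists g. Qed.

Lemma ellinf_norm_le (f : ellinf) (M : R) :
  (forall g, `|f g| <= M) -> ellinf_norm f <= M.
Proof.
move=> fM; apply: ge_sup; first exact: (ellinf_has_sup f).1.
by move=> _ [g _ <-].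
Qed.

Let ler_normD (f h : ellinf) :
  ellinf_norm (f + h) <= ellinf_norm f + ellinf_norm h.
Proof.
apply: ellinf_norm_le => g; rewrite (le_trans (ler_normD _ _))//.
by rewrite lerD// ellinf_norm_ge.
Qed.

Let normrZ (a : R) (f : ellinf) : ellinf_norm (a *: f) = `|a| * ellinf_norm f.
Proof.
have le b h : ellinf_norm (b *: h) <= `|b| * ellinf_norm h.
  apply: ellinf_norm_le => g; rewrite [leLHS]normrM.
  by rewrite ler_wpM2l// ellinf_norm_ge.
apply/eqP; rewrite eq_le le/=.
have [->|a0] := eqVneq a 0.
  by rewrite normr0 mul0r (le_trans _ (ellinf_norm_ge _ 1%g)).
rewrite -ler_pdivlMl ?normr_gt0// -normfV.
by rewrite -{1}(scalerK a0 f) le.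
Qed.

Let normr0_eq0 (f : ellinf) : ellinf_norm f = 0 -> f = 0.
Proof.
move=> f0; apply: ellinfP => g; apply/eqP.
by rewrite -normr_le0 -f0 ellinf_norm_ge.
Qed.

HB.instance Definition _ :=
  Lmodule_isNormed.Build R ellinf ler_normD normrZ normr0_eq0.

Fact ellinf_cst_subproof (c : R) : (fun=> c) \in bounded_pred.
Proof. by apply/bounded_predP; exists `|c|. Qed.
Definition ellinf_cst (c : R) : ellinf := Ellinf (ellinf_cst_subproof c).

Fact ellinf_mul_subproof (a f : ellinf) : (fun g => a g * f g) \in bounded_pred.
Proof.
have [M aM] := ellinf_bounded a; have [N fN] := ellinf_bounded f.
by apply/bounded_predP; exists (M * N) => g; rewrite normrM ler_pM.
Qed.
Definition ellinf_mul (a f : ellinf) : ellinf := Ellinf (ellinf_mul_subproof a f).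

Fact ellinf_abs_subproof (f : ellinf) : (fun g => `|f g|) \in bounded_pred.
Proof.
have [M fM] := ellinf_bounded f.
by apply/bounded_predP; exists M => g; rewrite normr_id.
Qed.
Definition ellinf_abs (f : ellinf) : ellinf := Ellinf (ellinf_abs_subproof f).

Fact ellinf_act_subproof (g : G) (f : ellinf) :
  (fun h => f (g^-1 * h)%g) \in bounded_pred.
Proof.
by have [M fM] := ellinf_bounded f; apply/bounded_predP; exists M.
Qed.
Definition ellinf_act (g : G) (f : ellinf) : ellinf :=
  Ellinf (ellinf_act_subproof g f).

End EllInf.

Section Exactness.
Context (R : realType) (G : groupType).
Local Notation C := (ellinf R G).

(* For a finitely supported f : G -> C this is the norm in C of the finite sum
   of the |f_g|, see [normuE] below; being defined (with value in [0, +oo]) for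
   every function, it also is the norm of the completion once the elements of
   the latter are regarded as functions. *)
Definition normu (xi : G -> C) : \bar R :=
  ereal_sup (range (fun h => \esum_(g in [set: G]) (`|xi g h|)%:E)%E).

Definition finsupp (xi : G -> C) : Prop := finite_set [set g | xi g != 0].

Lemma normuE (f : G -> C) : finsupp f ->
  normu f = (`| \sum_(g \in [set: G]) ellinf_abs (f g) |)%:E.
Proof.
move=> ffin; set A := [set g | f g != 0].
have fA0 g : g \notin fset_set A -> f g = 0.
  by rewrite in_fset_set// notin_setE /A/= => /negP; rewrite negbK => /eqP.
rewrite (@fsbigTE _ _ _ _ (fset_set A)); last first.
  by move=> g /fA0 ->; apply: ellinfP => h; rewrite /= normr0.
set c : C := \sum_(g <- _) _.
have cE h : c h = \sum_(g <- fset_set A) `|f g h|.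
  exact: (big_morph (fun u : C => u h) (fun _ _ => erefl) erefl).
have c0 h : 0 <= c h by rewrite cE sumr_ge0.
rewrite -[X in _ = X%:E]/(sup (range (fun h => `|c h|))) -ereal_sup_EFin; first last.
- exact: (ellinf_has_sup c).1.
- exact: (ellinf_has_sup c).2.
rewrite /normu image_comp; congr (ereal_sup (_ @` _)); apply/funext => h /=.
rewrite (ger0_norm (c0 h)) cE -sumEFin.
rewrite -(@fsbigTE _ _ _ _ (fset_set A) (fun g => (`|f g h|)%:E)); last first.
  by move=> g /fA0 ->; rewrite normr0.
rewrite -(@fsbig_widen _ _ _ _ A)//; last first.
  by move=> g [_ /negP]; rewrite negbK => /eqP /= ->; rewrite normr0.
rewrite -esum_fset// [RHS]esum_mkcond; apply: eq_esum => g _.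
case: ifPn => //; rewrite -in_fset_set// => /fA0 ->.
by rewrite normr0.
Qed.

(* The completion, realised inside the functions G -> C: the limits for normu
   of finitely supported functions. *)
Definition ellu : set (G -> C) :=
  [set xi | forall e : R, 0 < e ->
     exists2 f, finsupp f & (normu (xi - f)%R <= e%:E)%E].

Definition ellu_act (g : G) (xi : G -> C) : G -> C :=
  fun h => ellinf_act g (xi (g^-1 * h)%g).

Definition exact_group (S : seq G) : Prop :=
  forall e : R, 0 < e -> exists2 xi, ellu xi &
    [/\ finsupp xi,
        (forall g h, 0 <= xi g h) /\
          \sum_(g \in [set: G]) xi g = ellinf_cst G 1 &
        forall s, s \in S -> (normu (xi - ellu_act s xi)%R <= e%:E)%E].

End Exactness.

Definition generates (G : groupType) (S : seq G) : Prop :=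
  forall H : {pred G}, group_closed H -> {subset S <= H} -> forall g, g \in H.

Section BoundedOperators.
Context (R : realType) (X Y : normedModType R).

Definition blin_pred : {pred X -> Y} :=
  [pred T | `[< linear T /\ exists M : R, forall x, `|T x| <= M * `|x| >]].

Lemma blin_predP (T : X -> Y) :
  reflect (linear T /\ exists M : R, forall x, `|T x| <= M * `|x|)
          (T \in blin_pred).
Proof. by rewrite inE; exact: asboolP. Qed.

Lemma blin_pred_submod : submod_closed blin_pred.
Proof.
split.
  apply/blin_predP; split; first by move=> a u v; rewrite /= scaler0 addr0.
  by exists 0 => x; rewrite normr0 mul0r.
move=> a u v /blin_predP[ul [M uM]] /blin_predP[vl [N vN]].
apply/blin_predP; split.
  move=> b x y; rewrite -[LHS]/(a *: u (b *: x + y) + v (b *: x + y)) ul vl.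
  rewrite -[RHS]/(b *: (a *: u x + v x) + (a *: u y + v y)).
  by rewrite !scalerDr !scalerA (mulrC b a) addrACA.
exists (`|a| * M + N) => x; rewrite (le_trans (ler_normD _ _))// mulrDl lerD//.
by rewrite normrZ -mulrA ler_wpM2l.
Qed.

HB.instance Definition _ :=
  GRing.isSubmodClosed.Build R (X -> Y) blin_pred blin_pred_submod.

Record blin := Blin { blin_fun :> X -> Y; _ : blin_fun \in blin_pred }.

HB.instance Definition _ := [isSub for blin_fun].
HB.instance Definition _ := [Choice of blin by <:].
HB.instance Definition _ := [SubChoice_isSubLmodule of blin by <:].

Lemma blinP (T U : blin) : T =1 U -> T = U.
Proof. by move=> TU; apply/val_inj/funext. Qed.

Lemma blin_linE (a : R) (T U : blin) x : (a *: T + U) x = a *: T x + U x.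
Proof. by []. Qed.

Lemma blin_linear (T : blin) : linear T.
Proof. by case: T => T /= /blin_predP[]. Qed.

HB.instance Definition _ (T : blin) :=
  GRing.isLinear.Build R X Y *:%R (blin_fun T) (@blin_linear T).

Lemma blin_bounded (T : blin) : exists M : R, forall x, `|T x| <= M * `|x|.
Proof. by case: T => T /= /blin_predP[]. Qed.

Definition opnorm (T : blin) : R := sup [set `|T x| | x in [set x | `|x| <= 1]].

Lemma opnorm_has_sup (T : blin) : has_sup [set `|T x| | x in [set x | `|x| <= 1]].
Proof.
split; first by exists `|T 0|; exists 0 => //=; rewrite normr0.
have [M TM] := blin_bounded T; exists `|M| => _ [x /= x1 <-].
rewrite (le_trans (TM x))// (le_trans (ler_norm _))// normrM normr_id.
by rewrite ler_piMr.
Qed.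

Lemma opnorm_ge0 (T : blin) : 0 <= opnorm T.
Proof.
apply: (ub_le_sup (opnorm_has_sup T).2); exists 0; rewrite /= ?normr0//.
by rewrite linear0 normr0.
Qed.

Lemma opnormP (T : blin) x : `|T x| <= opnorm T * `|x|.
Proof.
have [->|x0] := eqVneq x 0; first by rewrite linear0 !normr0 mulr0.
rewrite -ler_pdivrMr ?normr_gt0// mulrC.
have -> : `|x|^-1 * `|T x| = `|T (`|x|^-1 *: x)|.
  by rewrite linearZ normrZ ger0_norm ?invr_ge0.
apply: (ub_le_sup (opnorm_has_sup T).2); exists (`|x|^-1 *: x) => //=.
by rewrite normrZ normfV normr_id mulVf ?normr_eq0.
Qed.

Lemma opnorm_le (T : blin) (M : R) : 0 <= M ->
  (forall x, `|T x| <= M * `|x|) -> opnorm T <= M.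
Proof.
move=> M0 TM; apply: ge_sup; first exact: (opnorm_has_sup T).1.
by move=> _ [x /= x1 <-]; rewrite (le_trans (TM x))// ler_piMr.
Qed.

Let ler_normD (T U : blin) : opnorm (T + U) <= opnorm T + opnorm U.
Proof.
apply: opnorm_le => [|x]; first by rewrite addr_ge0 ?opnorm_ge0.
by rewrite (le_trans (ler_normD _ _))// mulrDl lerD// opnormP.
Qed.

Let normrZ (a : R) (T : blin) : opnorm (a *: T) = `|a| * opnorm T.
Proof.
have le b U : opnorm (b *: U) <= `|b| * opnorm U.
  apply: opnorm_le => [|x]; first by rewrite mulr_ge0 ?opnorm_ge0.
  by rewrite [leLHS]normrZ -mulrA ler_wpM2l// opnormP.
apply/eqP; rewrite eq_le le/=.
have [->|a0] := eqVneq a 0; first by rewrite normr0 mul0r opnorm_ge0.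
rewrite -ler_pdivlMl ?normr_gt0// -normfV.
by rewrite -{1}(scalerK a0 T) le.
Qed.

Let normr0_eq0 (T : blin) : opnorm T = 0 -> T = 0.
Proof.
move=> T0; apply: blinP => x; apply/eqP.
by rewrite -normr_le0 (le_trans (opnormP _ _))// T0 mul0r.
Qed.

HB.instance Definition _ :=
  Lmodule_isNormed.Build R blin ler_normD normrZ normr0_eq0.

End BoundedOperators.

Section Modules.
Context (R : realType) (G : groupType) (X : completeNormedModType R).
Local Notation C := (ellinf R G).
Local Notation L := (blin X C).

(* Invertibility of the operators Phi g follows from the first two clauses. *)
Definition bounded_gmodule (Phi : G -> blin X X) : Prop :=
  [/\ forall x, Phi 1%g x = x,
      forall g h x, Phi (g * h)%g x = Phi g (Phi h x) &
      exists M : R, forall g, `|Phi g| <= M].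

Fact hopf_act_subproof (Phi : G -> blin X X) (g : G) (T : L) :
  (fun x => ellinf_act g (T (Phi g^-1%g x))) \in @blin_pred R X C.
Proof.
apply/blin_predP; split.
  by move=> a x y; rewrite !linearP; apply: ellinfP.
exists (`|T| * `|Phi g^-1%g|) => x; rewrite -mulrA.
apply: le_trans (ler_wpM2l (normr_ge0 T) (opnormP _ x)).
apply: le_trans (opnormP T _); apply: ellinf_norm_le => h.
exact: (ellinf_norm_ge (T (Phi g^-1%g x)) (g^-1 * h)%g).
Qed.

Definition hopf_act (Phi : G -> blin X X) (g : G) (T : L) : L :=
  Blin (hopf_act_subproof Phi g T).

Fact hopf_mul_subproof (a : C) (T : L) :
  (fun x => ellinf_mul a (T x)) \in @blin_pred R X C.
Proof.
apply/blin_predP; split.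
  move=> b x y; rewrite !linearP; apply: ellinfP => h /=.
  rewrite -[LHS]/(a h * (b * T x h + T y h)).
  rewrite -[RHS]/(b * (a h * T x h) + a h * T y h).
  by rewrite mulrDr mulrCA.
exists (`|a| * `|T|) => x; rewrite -mulrA.
apply: le_trans (ler_wpM2l (normr_ge0 a) (opnormP T x)).
apply: ellinf_norm_le => h; rewrite normrM.
by rewrite ler_pM// ellinf_norm_ge.
Qed.

Definition hopf_mul (a : C) (T : L) : L := Blin (hopf_mul_subproof a T).

Lemma hopf_act_linear (Phi : G -> blin X X) g : linear (hopf_act Phi g).
Proof.
move=> a T U; apply: blinP => x; apply: ellinfP => h.
rewrite -[LHS]/((a *: T + U) (Phi g^-1%g x) (g^-1 * h)%g).
by rewrite !blin_linE !ellinf_linE.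
Qed.

Record hopfModule (Phi : G -> blin X X) := HopfModule {
  hopf_set :> set L;
  hopf_0 : hopf_set 0;
  hopf_lin : forall (a : R) T U,
    hopf_set T -> hopf_set U -> hopf_set (a *: T + U);
  hopf_G : forall g T, hopf_set T -> hopf_set (hopf_act Phi g T);
  hopf_C : forall a T, hopf_set T -> hopf_set (hopf_mul a T) }.

End Modules.

Section WeakStar.
Context (R : realType) (G : groupType) (X : completeNormedModType R).
Local Notation L := (blin X (ellinf R G)).

Definition ell1 : Type :=
  {a : G -> X | (\esum_(g in [set: G]) (`|a g|)%:E < +oo)%E}.

(* the sum of an absolutely summable real family *)
Definition sumR (f : G -> R) : R :=
  fine (\esum_(g in [set: G]) (f^\+ g)%:E)%E -
  fine (\esum_(g in [set: G]) (f^\- g)%:E)%E.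

(* T corresponds to g |-> (x |-> T x g) in l_oo(G, X^* ), the dual of
   l_1(G, X). *)
Definition pairing (T : L) : {ptws ell1 -> R} :=
  fun a => sumR (fun g => T (sval a g) g).

Definition weak_star := initial_topology pairing.

Definition weak_star_closed (E : set L) : Prop := closed (E : set weak_star).

End WeakStar.

Section BoundedCohomology.
Context (R : realType) (G : groupType) (X : completeNormedModType R).
Context (Phi : G -> blin X X).
Local Notation L := (blin X (ellinf R G)).

(* (g_1, ..., g_(n+1)) |-> (g_1, ..., g_i g_(i+1), ..., g_(n+1)); the indices
   are shifted by one, since 'I_n starts from 0. *)
Definition merge (n : nat) (i : 'I_n) (g : 'I_n.+1 -> G) : 'I_n -> G :=
  fun j => if (j < i)%N then g (widen_ord (leqnSn n) j)
           else if j == i then (g (widen_ord (leqnSn n) j) * g (lift ord0 j))%g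
           else g (lift ord0 j).

Definition cdiff (n : nat) (b : ('I_n -> G) -> L) (g : 'I_n.+1 -> G) : L :=
  hopf_act Phi (g ord0) (b (fun j => g (lift ord0 j)))
  + \sum_(i < n) (-1) ^+ i.+1 *: b (merge i g)
  + (-1) ^+ n.+1 *: b (fun j => g (widen_ord (leqnSn n) j)).

Lemma cdiff_linear n : linear (@cdiff n).
Proof.
move=> a b c; apply/funext => g.
rewrite -[RHS]/(a *: cdiff b g + cdiff c g) /cdiff.
rewrite -[X in hopf_act _ _ X]/(a *: b _ + c _) hopf_act_linear.
under eq_bigr => i _ do rewrite -[X in _ *: X]/(a *: b _ + c _) scalerDr
  scalerA mulrC -scalerA.
rewrite big_split/= -scaler_sumr -[X in _ + _ *: X]/(a *: b _ + c _).
rewrite scalerDr scalerA (mulrC _ a) -scalerA !scalerDr.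
by rewrite [RHS]addrACA [X in _ = X + _]addrACA.
Qed.

Definition cochain (E : set L) (n : nat) : set (('I_n -> G) -> L) :=
  [set b | (forall g, E (b g)) /\ exists M : R, forall g, `|b g| <= M].

Definition coboundary (E : set L) (n : nat) : set (('I_n -> G) -> L) :=
  match n return set (('I_n -> G) -> L) with
  | 0 => [set 0]
  | m.+1 => [set cdiff c | c in @cochain E m]
  end.

Context (E : hopfModule Phi) (n : nat).

Definition cocycle_pred : {pred ('I_n -> G) -> L} :=
  [pred b | `[< cochain E b /\ cdiff b = 0 >]].

Lemma cocycle_predP (b : ('I_n -> G) -> L) :
  reflect (cochain E b /\ cdiff b = 0) (b \in cocycle_pred).
Proof. by rewrite inE; exact: asboolP. Qed.

Lemma cochain_lin m (a : R) (b c : ('I_m -> G) -> L) :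
  cochain E b -> cochain E c -> cochain E (a *: b + c).
Proof.
move=> [Eb [M bM]] [Ec [N cN]]; split=> [g|]; first exact: hopf_lin.
exists (`|a| * M + N) => g; rewrite (le_trans (ler_normD _ _))// lerD//.
by rewrite normrZ ler_wpM2l.
Qed.

Lemma cochain0 m : cochain E (0 : ('I_m -> G) -> L).
Proof.
by split=> [g|]; [exact: hopf_0 | exists 0 => g; rewrite normr0].
Qed.

Lemma cocycle_submod : submod_closed cocycle_pred.
Proof.
have cdiff0 m : @cdiff m 0 = 0.
  by have := cdiff_linear (-1) (0 : ('I_m -> G) -> L) 0;
    rewrite scaler0 addr0 scaleN1r addNr.
split; first by apply/cocycle_predP; split; [exact: cochain0|exact: cdiff0].
move=> a b c /cocycle_predP[Eb b0] /cocycle_predP[Ec c0].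
apply/cocycle_predP; split; first exact: cochain_lin.
by rewrite cdiff_linear b0 c0 scaler0 addr0.
Qed.

HB.instance Definition _ :=
  GRing.isSubmodClosed.Build R (('I_n -> G) -> L) cocycle_pred cocycle_submod.

Record cocycle :=
  Cocycle { cocycle_fun :> ('I_n -> G) -> L; _ : cocycle_fun \in cocycle_pred }.

HB.instance Definition _ := [isSub for cocycle_fun].
HB.instance Definition _ := [Choice of cocycle by <:].
HB.instance Definition _ := [SubChoice_isSubLmodule of cocycle by <:].

(* For a bounded G-module X every coboundary is a cocycle, so that requiring it
   loses nothing. *)
Definition coboundary_pred : {pred cocycle} :=
  [pred b : cocycle | `[< coboundary E (cocycle_fun b) >]].

Lemma coboundary_predP (b : cocycle) :
  reflect (coboundary E (cocycle_fun b)) (b \in coboundary_pred).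
Proof. by rewrite inE; exact: asboolP. Qed.

Lemma coboundary_zmod : zmod_closed coboundary_pred.
Proof.
suff cob_lin m : coboundary E (0 : ('I_m -> G) -> L) /\
    forall b c : ('I_m -> G) -> L,
      coboundary E b -> coboundary E c -> coboundary E (b - c).
  split; first by apply/coboundary_predP; exact: (cob_lin n).1.
  move=> b c /coboundary_predP Eb /coboundary_predP Ec.
  by apply/coboundary_predP; exact: (cob_lin n).2.
case: m => [|m]; first by split=> // b c /= -> ->; rewrite subr0.
have cdiffB (b c : ('I_m -> G) -> L) : cdiff (b - c) = cdiff b - cdiff c.
  by rewrite addrC -scaleN1r cdiff_linear scaleN1r addrC.
split; first by exists 0; [exact: cochain0|rewrite -(subrr 0) cdiffB subrr].
move=> _ _ [b Eb <-] [c Ec <-]; exists (b - c) => //.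
by rewrite addrC -scaleN1r; exact: cochain_lin.
Qed.

HB.instance Definition _ :=
  GRing.isZmodClosed.Build cocycle coboundary_pred coboundary_zmod.

Definition Hb : zmodType := Quotient.quot coboundary_pred.

End BoundedCohomology.

(* Main.v *)
From HB Require Import structures.
From mathcomp Require Import finmap.
Require Import Defs.
From mathcomp Require Import all_boot all_order all_algebra.
From mathcomp Require Import ring lra.
From mathcomp Require Import all_classical all_reals all_analysis.
Set Implicit Arguments.
Unset Strict Implicit.
Unset Printing Implicit Defensive.
Import Order.TTheory GRing.Theory Num.Theory.
Import numFieldNormedType.Exports.
Local Open Scope classical_set_scope.
Local Open Scope ring_scope.

(* Let [xi^k] be finitely supported probability-valued functions with
   [normu (xi^k - g . xi^k) -> 0] for every [g].  Given a bounded cocycle [b] of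
   degree [n+1], put
     [c_k (g_1, .., g_n) = \sum_h xi^k_h (h . b (h^-1, g_1, .., g_n))].
   Applying [h] to the cocycle identity at [(h^-1, g_1, .., g_(n+1))] and
   averaging gives that [b - d c_k] at [(g_1, .., g_(n+1))] is the average of
   the bounded family [h . b (h^-1 g_1, g_2, .., g_(n+1))] against
   [xi^k - g_1 . xi^k], hence tends to [0].  The [c_k] are uniformly bounded,
   so they converge pointwise along an ultrafilter; on bounded sets pointwise
   convergence is weak-* convergence, so the limit [c] takes values in [E], and
   [d c = b]. *)

Lemma initial_cvg (I : Type) (F : set_system I) {FF : Filter F}
    (S : choiceType) (T : topologicalType) (f : S -> T) (u : I -> S) (s : S) :
  f \o u @ F --> f s -> u @ F --> (s : initial_topology f).
Proof.
move=> fu A [_ [[B Bo <-] Bfs BA]].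
have /fu : nbhs (f s) B by exact: open_nbhs_nbhs.
by apply: (@filterS _ F) => i /BA.
Qed.

Lemma ptws_cvg (I : Type) (F : set_system I) {FF : Filter F} (J : Type)
    (V : topologicalType) (u : I -> {ptws J -> V}) (v : {ptws J -> V}) :
  (forall j, u i j @[i --> F] --> v j) -> u @ F --> v.
Proof.
move=> uv; apply/cvg_sup => j.
by apply: (@initial_cvg _ F FF _ _ (fun f : J -> V => f j)); exact: uv.
Qed.

Lemma ultra_bounded_cvg (R : realType) (I : Type) (U : set_system I)
    {UU : UltraFilter U} (u : I -> R) (M : R) :
  (forall i, `|u i| <= M) -> exists l : R, u @ U --> l.
Proof.
move=> uM.
have [|l [_ cl]] := @segment_compact R (- M) M (u @ U) _.
  by rewrite /nbhs/=; apply: (@filterE _ U) => i /=; rewrite in_itv/= -ler_norml.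
exists l => V Vl; have [//|UV] := in_ultra_setVsetC (u @^-1` V) UU.
by have [r []] := cl (~` V) V UV Vl.
Qed.

Section EsumTail.
Context (R : realType) (T : choiceType).

Lemma esum_fsetE (f : T -> R) (A : {fset T}) : (forall g, 0 <= f g) ->
  (\esum_(g in [set` A]) (f g)%:E = (\sum_(g <- A) f g)%:E)%E.
Proof.
move=> f0; rewrite esum_fset//; last by move=> g _; rewrite lee_fin.
by rewrite -fsbig_seq ?fset_uniq// sumEFin.
Qed.

Lemma esum_tail_le (f : T -> R) (e : R) : (forall g, 0 <= f g) ->
  (\esum_(g in [set: T]) (f g)%:E < +oo)%E -> 0 < e ->
  exists A : {fset T}, (\esum_(g in ~` [set` A]) (f g)%:E <= e%:E)%E.
Proof.
move=> f0 foo e0.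
have f0' g : (0 <= (f g)%:E)%E by rewrite lee_fin.
have ffin : \esum_(g in [set: T]) (f g)%:E \is a fin_num.
  by rewrite ge0_fin_numE// esum_ge0.
have [_ [B [Bfin _] <-]] := ub_ereal_sup_adherent e0 ffin.
rewrite -/(esum _ _) => Ae; exists (fset_set B); move: Ae.
rewrite (esumID [set` fset_set B])// !setTI.
rewrite esum_fsetE// fset_setK// fsbig_finite//= sumEFin.
case: (\esum_(g in _) _)%E => [r||]//=; last by rewrite leNye.
by rewrite lte_fin lee_fin; lra.
Qed.

End EsumTail.

Lemma sumR_approx (R : realType) (G : groupType) (f : G -> R) (A : {fset G})
    (e : R) : (\esum_(g in ~` [set` A]) (`|f g|)%:E <= e%:E)%E ->
  `|sumR f - \sum_(g <- A) f g| <= e.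
Proof.
move=> fe.
have tail (u : G -> R) : (forall g, 0 <= u g <= `|f g|) ->
    exists2 t, 0 <= t <= e &
      fine (\esum_(g in [set: G]) (u g)%:E)%E = \sum_(g <- A) u g + t.
  move=> u_f; have u0 g : 0 <= u g by case/andP: (u_f g).
  rewrite (esumID [set` A]) ?setTI//; last by move=> g _; rewrite lee_fin.
  rewrite esum_fsetE//.
  have t0 : (0 <= \esum_(g in ~` [set` A]) (u g)%:E)%E.
    by apply: esum_ge0 => g _; rewrite lee_fin.
  have te : (\esum_(g in ~` [set` A]) (u g)%:E <= e%:E)%E.
    apply: le_trans fe; apply: le_esum => g _.
    by rewrite lee_fin; case/andP: (u_f g).
  have tfin : \esum_(g in ~` [set` A]) (u g)%:E \is a fin_num.
    by rewrite ge0_fin_numE// (le_lt_trans te)// ltry.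
  exists (fine (\esum_(g in ~` [set` A]) (u g)%:E)); last by rewrite fineD.
  by rewrite -!lee_fin fineK// t0.
have fE g : f^\+ g + f^\- g = `|f g|.
  by rewrite -[RHS](congr1 (@^~ g) (funrposDneg f)).
have [|t t_e p] := tail (f^\+).
  by move=> g; rewrite funrpos_ge0 -fE lerDl funrneg_ge0.
have [|s s_e n] := tail (f^\-).
  by move=> g; rewrite funrneg_ge0 -fE lerDr funrpos_ge0.
rewrite /sumR p n.
have -> : \sum_(g <- A) f g = \sum_(g <- A) f^\+ g - \sum_(g <- A) f^\- g.
  rewrite -sumrB; apply: eq_bigr => g _.
  by rewrite -[LHS](congr1 (@^~ g) (funrposBneg f)).
by rewrite ler_norml; lra.
Qed.

Lemma esum_mul_le (R : realType) (T : choiceType) (D : set T) (f : T -> R)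
    (N d : R) : 0 <= N -> (\esum_(g in D) (f g)%:E <= d%:E)%E ->
  (\esum_(g in D) (N * f g)%:E <= (N * d)%:E)%E.
Proof.
move=> N0 fd; apply: ge_ereal_sup => _ [B [Bfin BD] <-].
rewrite fsbig_finite// sumEFin -mulr_sumr lee_fin ler_wpM2l//.
rewrite -lee_fin -sumEFin -fsbig_finite//; apply: le_trans fd.
by apply: ereal_sup_ubound; exists B.
Qed.

Section Evaluation.
Context (R : realType) (G : groupType) (X : completeNormedModType R).
Local Notation L := (blin X (ellinf R G)).

Definition eval_at (x : X) (h : G) (T : L) : R := T x h.

Lemma eval_atP x h (a : R) (T U : L) :
  eval_at x h (a *: T + U) = a * eval_at x h T + eval_at x h U.
Proof. by rewrite /eval_at blin_linE ellinf_linE. Qed.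

Lemma eval_at_is_zmod_morphism x h : zmod_morphism (eval_at x h).
Proof.
by move=> T U; rewrite addrC -scaleN1r eval_atP mulN1r addrC.
Qed.

HB.instance Definition _ x h :=
  GRing.isZmodMorphism.Build L R (eval_at x h) (@eval_at_is_zmod_morphism x h).

Lemma eval_atZ x h (a : R) (T : L) : eval_at x h (a *: T) = a * eval_at x h T.
Proof. by rewrite -[a *: T]addr0 eval_atP raddf0 addr0. Qed.

Lemma eval_at_sumZ x h (I : Type) (r : seq I) (a : I -> R) (T : I -> L) :
  eval_at x h (\sum_(i <- r) a i *: T i) = \sum_(i <- r) a i * eval_at x h (T i).
Proof. by rewrite raddf_sum; apply: eq_bigr => i _; rewrite /= eval_atZ. Qed.

Lemma eval_at_ext (T U : L) : (forall x h, eval_at x h T = eval_at x h U) ->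
  T = U.
Proof. by move=> TU; apply: blinP => x; apply: ellinfP => h; exact: TU. Qed.

Lemma eval_at_le (T : L) x h : `|eval_at x h T| <= `|T| * `|x|.
Proof. by apply: le_trans (opnormP T x); exact: ellinf_norm_ge. Qed.

Lemma norm_le_eval (T : L) (M : R) : 0 <= M ->
  (forall x h, `|eval_at x h T| <= M * `|x|) -> `|T| <= M.
Proof.
by move=> M0 TM; apply: opnorm_le => // x; apply: ellinf_norm_le => h; exact: TM.
Qed.

Lemma weak_star_cvg (I : Type) (F : set_system I) {FF : Filter F}
    (T_ : I -> L) (T : L) (M : R) : (forall i, `|T_ i| <= M) ->
    (forall x h, eval_at x h (T_ i) @[i --> F] --> eval_at x h T) ->
  T_ @ F --> (T : weak_star G X).
Proof.
move=> T_M T_T; apply: initial_cvg; apply: ptws_cvg => -[a a_oo] /=.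
apply/cvgrPdist_le => e e0.
pose N := Num.max M `|T| + 1.
have TN : `|T| <= N by rewrite /N ler_wpDr// le_max lexx orbT.
have T_N i : `|T_ i| <= N by rewrite /N ler_wpDr// le_max T_M.
have N0 : 0 < N by rewrite ltr_wpDl// le_max normr_ge0 orbT.
have d0 : 0 < e / (3 * N) by rewrite divr_gt0// mulr_gt0.
have [A Ae] := esum_tail_le (fun g => normr_ge0 (a g)) a_oo d0.
have approx (U : L) : `|U| <= N ->
    `|pairing U (exist _ a a_oo) - \sum_(g <- A) U (a g) g| <= e / 3.
  move=> UN; apply: sumR_approx.
  have -> : e / 3 = N * (e / (3 * N)) by field; rewrite gt_eqF.
  apply: le_trans (esum_mul_le (ltW N0) Ae); apply: le_esum => g _.
  by rewrite lee_fin (le_trans (eval_at_le _ _ _))// ler_wpM2r.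
have : \sum_(g <- A) T_ i (a g) g @[i --> F] --> \sum_(g <- A) T (a g) g.
  by apply: cvg_big => [|g _]; [exact: add_continuous|exact: T_T].
move=> /cvgrPdist_le/(_ _ (divr_gt0 e0 (ltr0Sn _ 2))).
apply: filterS => i /=.
have := approx _ TN; have := approx _ (T_N i).
rewrite !ler_norml; lra.
Qed.

Lemma weak_star_ultra_limit (I : Type) (U : set_system I) {UU : UltraFilter U}
    (T_ : I -> L) (M : R) : (forall i, `|T_ i| <= M) ->
  exists2 T : L, `|T| <= M &
    forall x h, eval_at x h (T_ i) @[i --> U] --> eval_at x h T.
Proof.
move=> T_M.
have M0 : I -> 0 <= M by move=> i; exact: le_trans (T_M i).
have [i0 _] : exists i : I, True.
  by have [i _] := @filter_ex _ U _ setT filterT; exists i.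
have T_x x h i : `|eval_at x h (T_ i)| <= M * `|x|.
  by rewrite (le_trans (eval_at_le _ _ _))// ler_wpM2r.
have /choice[l lE] (xh : X * G) :
    exists l : R, eval_at xh.1 xh.2 (T_ i) @[i --> U] --> l.
  exact: ultra_bounded_cvg (T_x xh.1 xh.2).
have l_le x h : `|l (x, h)| <= M * `|x|.
  have : `[- (M * `|x|), M * `|x|]%classic (l (x, h)).
    apply: closed_cvg (lE (x, h)); first exact: itv_closed.
    by apply: nearW => i; rewrite /= in_itv/= -ler_norml.
  by rewrite /= in_itv/= -ler_norml.
have l_lin a x y h : l (a *: x + y, h) = a * l (x, h) + l (y, h).
  apply: cvg_unique (lE (_, h)) _ => //.
  have E i : eval_at (a *: x + y) h (T_ i) =
      a * eval_at x h (T_ i) + eval_at y h (T_ i) by rewrite /eval_at linearP.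
  rewrite /=; under eq_fun do rewrite E.
  by apply: cvgD; [apply: cvgMl_tmp; exact: lE (x, h)|exact: lE (y, h)].
have lb x : (fun h => l (x, h)) \in @bounded_pred R G.
  by apply/bounded_predP; exists (M * `|x|).
have ll : (fun x => Ellinf (lb x)) \in @blin_pred R X (ellinf R G).
  apply/blin_predP; split.
    by move=> a x y; apply: ellinfP => h; exact: l_lin.
  by exists M => x; apply: ellinf_norm_le => h; exact: l_le.
exists (Blin ll); first by apply: norm_le_eval (M0 i0) _; exact: l_le.
by move=> x h; exact: lE (x, h).
Qed.

End Evaluation.

Section UniformNorm.
Context (R : realType) (G : groupType).
Local Notation C := (ellinf R G).
Implicit Types (xi eta : G -> C) (g : G).

Lemma normu_point xi h : (\esum_(g in [set: G]) (`|xi g h|)%:E <= normu xi)%E.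
Proof. by apply: ereal_sup_ubound; exists h. Qed.

Lemma normu_le xi (e : \bar R) :
  (forall h, (\esum_(g in [set: G]) (`|xi g h|)%:E <= e)%E) -> (normu xi <= e)%E.
Proof. by move=> xie; apply: ge_ereal_sup => _ [h _ <-]. Qed.

Lemma normuD xi eta : (normu (xi + eta)%R <= normu xi + normu eta)%E.
Proof.
apply: normu_le => h.
apply: le_trans (leeD (normu_point xi h) (normu_point eta h)).
rewrite -esumD => [|g _|g _]; rewrite ?lee_fin//.
by apply: le_esum => g _; rewrite -EFinD lee_fin ler_normD.
Qed.

Lemma normuN xi : normu (- xi) = normu xi.
Proof.
rewrite /normu; congr (ereal_sup (_ @` _)); apply/funext => h.
by apply: eq_esum => g _; rewrite -[X in `|X|]/(- xi g h) normrN.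
Qed.

Lemma ellu_actM g h xi : ellu_act (g * h)%g xi = ellu_act g (ellu_act h xi).
Proof.
by apply/funext => k; apply: ellinfP => l; rewrite /= /ellu_act/= invgM !mulgA.
Qed.

Lemma ellu_act1 xi : ellu_act 1%g xi = xi.
Proof.
by apply/funext => k; apply: ellinfP => l; rewrite /= /ellu_act/= invg1 !mul1g.
Qed.

Lemma ellu_actB g xi eta : ellu_act g (xi - eta) = ellu_act g xi - ellu_act g eta.
Proof. by apply/funext => k; apply: ellinfP. Qed.

Lemma mulg_bij g : bijective ( *%g g).
Proof. by exists ( *%g g^-1%g) => h /=; rewrite (mulKg, mulVKg). Qed.

Lemma normu_act g xi : (normu (ellu_act g xi) <= normu xi)%E.
Proof.
apply: normu_le => h.
apply: le_trans (normu_point xi (g^-1 * h)%g).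
rewrite (@reindex_esum _ _ _ setT _ ( *%g g)).
  by apply: le_esum => k _; rewrite /ellu_act/= mulKg.
by rewrite setTT_bijective; exact: mulg_bij.
Qed.

Lemma finsuppE xi : finsupp xi ->
  exists A : {fset G}, forall g, g \notin A -> xi g = 0.
Proof.
move=> xifin; exists (fset_set [set g | xi g != 0]) => g.
by rewrite in_fset_set// notin_setE /= => /negP; rewrite negbK => /eqP.
Qed.

Lemma finsupp_act g xi : finsupp xi -> finsupp (ellu_act g xi).
Proof.
move=> xifin; apply: sub_finite_set (finite_image ( *%g g) xifin) => h /= xih.
exists (g^-1 * h)%g; rewrite ?mulVKg//=; apply: contra_neq xih => xih.
by apply: ellinfP => k; rewrite /ellu_act xih.
Qed.

Lemma finsuppB xi eta : finsupp xi -> finsupp eta -> finsupp (xi - eta).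
Proof.
move=> xifin etafin.
have fin : finite_set ([set g | xi g != 0] `|` [set g | eta g != 0]).
  by rewrite finite_setU.
apply: sub_finite_set fin => g; rewrite /= -[X in X != 0]/(xi g - eta g).
have [->|?] := eqVneq (xi g) 0; last by left.
by rewrite sub0r oppr_eq0; right.
Qed.

Lemma normu_prob xi : finsupp xi -> (forall g h, 0 <= xi g h) ->
  \sum_(g \in [set: G]) xi g = ellinf_cst G 1 -> (normu xi <= 1)%E.
Proof.
move=> xifin xi0 xi1; rewrite normuE// lee_fin.
under eq_fsbigr => g _.
  rewrite (_ : ellinf_abs _ = xi g); last first.
    by apply: ellinfP => h /=; rewrite ger0_norm.
  over.
rewrite xi1; apply: ellinf_norm_le => h /=.
by rewrite normr1.
Qed.

Lemma exact_asymptotic_invariance (S : seq G) :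
  generates S -> exact_group R S ->
  exists xi : nat -> G -> C,
    [/\ forall k, finsupp (xi k),
        forall k g h, 0 <= xi k g h,
        forall k, \sum_(g \in [set: G]) xi k g = ellinf_cst G 1 &
        forall g e, 0 < e ->
          \forall k \near \oo, (normu (xi k - ellu_act g (xi k))%R <= e%:E)%E].
Proof.
move=> S_gen exactS.
have /choice[xi xiP] (k : nat) : exists xi : G -> C,
    [/\ finsupp xi, forall g h, 0 <= xi g h,
        \sum_(g \in [set: G]) xi g = ellinf_cst G 1 &
        forall s, s \in S -> (normu (xi - ellu_act s xi)%R <= k.+1%:R^-1%:E)%E].
  have [|xi _ [? [? ?] ?]] := exactS k.+1%:R^-1; first by rewrite invr_gt0.
  by exists xi.
exists xi; split; [by move=> k; case: (xiP k)..|].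
pose H : {pred G} := [pred g | `[< forall e : R, 0 < e ->
  \forall k \near \oo, (normu (xi k - ellu_act g (xi k))%R <= e%:E)%E >]].
suff HG g : g \in H by move=> g; apply/asboolP; exact: HG.
apply: S_gen => [|s sS]; first split.
- apply/asboolP => e e0; apply: nearW => k; rewrite ellu_act1 subrr.
  apply: normu_le => h; rewrite esum1 ?lee_fin ?ltW// => l _.
  by rewrite normr0.
- move=> u v /asboolP Hu /asboolP Hv; apply/asboolP => e e0.
  have e20 : 0 < e / 2 by rewrite divr_gt0.
  near=> k.
  rewrite (_ : _ - _ = (xi k - ellu_act u (xi k)) +
    ellu_act (u * v^-1)%g (- (xi k - ellu_act v (xi k)))); last first.
    rewrite opprB ellu_actB -[in X in _ + (X - _)]ellu_actM.
    by rewrite -mulgA mulVg mulg1 addrA subrK.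
  apply: le_trans (normuD _ _) _.
  rewrite [e]splitr EFinD; apply: leeD; first by near: k; exact: Hu.
  apply: le_trans (normu_act _ _) _; rewrite normuN.
  by near: k; exact: Hv.
- apply/asboolP => e e0; near=> k; have [_ _ _ /(_ _ sS)] := xiP k.
  move=> /le_trans; apply; rewrite lee_fin; apply: ltW.
  by near: k; exact: near_infty_natSinv_lt (PosNum e0).
Unshelve. all: by end_near. Qed.

End UniformNorm.

Section Averages.
Context (R : realType) (G : groupType) (X : completeNormedModType R).
Local Notation C := (ellinf R G).
Local Notation L := (blin X C).
Implicit Types (xi eta : G -> C) (beta : G -> L).

Definition avg xi beta : L := \sum_(h \in [set: G]) hopf_mul (xi h) (beta h).

Lemma avg_fset (A : {fset G}) xi beta :
  (forall h, h \notin A -> xi h = 0) ->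
  avg xi beta = \sum_(h <- A) hopf_mul (xi h) (beta h).
Proof.
move=> xiA; apply: fsbigTE => h /xiA ->.
by apply: eval_at_ext => x g; exact: mul0r.
Qed.

Lemma eval_avg (A : {fset G}) xi beta x g :
  (forall h, h \notin A -> xi h = 0) ->
  eval_at x g (avg xi beta) = \sum_(h <- A) xi h g * eval_at x g (beta h).
Proof. by move=> /avg_fset ->; rewrite raddf_sum. Qed.

Lemma avg0r xi : avg xi (fun=> 0) = 0.
Proof.
by apply: fsbig1 => h _; apply: eval_at_ext => x g; exact: mulr0.
Qed.

Lemma avgDr xi beta1 beta2 : finsupp xi ->
  avg xi (fun h => beta1 h + beta2 h) = avg xi beta1 + avg xi beta2.
Proof.
move=> /finsuppE[A xiA]; apply: eval_at_ext => x g.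
rewrite raddfD /= !(eval_avg _ _ _ xiA) -big_split/=.
by apply: eq_bigr => h _; rewrite raddfD mulrDr.
Qed.

Lemma avgZr xi beta (a : R) : finsupp xi ->
  avg xi (fun h => a *: beta h) = a *: avg xi beta.
Proof.
move=> /finsuppE[A xiA]; apply: eval_at_ext => x g.
rewrite eval_atZ !(eval_avg _ _ _ xiA) mulr_sumr.
by apply: eq_bigr => h _; rewrite eval_atZ mulrCA.
Qed.

Lemma avg_sumr (I : Type) (r : seq I) xi (beta : I -> G -> L) : finsupp xi ->
  avg xi (fun h => \sum_(i <- r) beta i h) = \sum_(i <- r) avg xi (beta i).
Proof.
move=> xifin; elim: r => [|i r IHr].
  rewrite big_nil -[RHS](avg0r xi); congr avg.
  by apply/funext => h; rewrite big_nil.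
rewrite big_cons -IHr -avgDr//.
by congr avg; apply/funext => h; rewrite big_cons.
Qed.

Lemma avgBl xi eta beta : finsupp xi -> finsupp eta ->
  avg (xi - eta) beta = avg xi beta - avg eta beta.
Proof.
move=> /finsuppE[A xiA] /finsuppE[B etaB]; apply: eval_at_ext => x g.
have xiAB h : h \notin (A `|` B)%fset -> xi h = 0.
  by rewrite inE negb_or => /andP[/xiA].
have etaAB h : h \notin (A `|` B)%fset -> eta h = 0.
  by rewrite inE negb_or => /andP[_ /etaB].
rewrite raddfB /= (eval_avg _ _ _ xiAB) (eval_avg _ _ _ etaAB).
rewrite (@eval_avg (A `|` B)%fset); last first.
  by move=> h hAB; rewrite -[LHS]/(xi h - eta h) xiAB// etaAB// subr0.
by rewrite -sumrB; apply: eq_bigr => h _; exact: mulrBl.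
Qed.

Lemma avg_cst xi (T : L) : finsupp xi ->
  \sum_(g \in [set: G]) xi g = ellinf_cst G 1 -> avg xi (fun=> T) = T.
Proof.
move=> /finsuppE[A xiA]; rewrite (fsbigTE A)// => xi1.
apply: eval_at_ext => x g; rewrite (eval_avg _ _ _ xiA) -mulr_suml.
have -> : \sum_(h <- A) xi h g = (\sum_(h <- A) xi h) g.
  by apply/esym; apply: (big_morph (fun u : C => u g)).
by rewrite xi1 mul1r.
Qed.

Lemma norm_avg_le xi beta (e K : R) : finsupp xi -> 0 <= e -> 0 <= K ->
  (normu xi <= e%:E)%E -> (forall h, `|beta h| <= K) ->
  `|avg xi beta| <= e * K.
Proof.
move=> /finsuppE[A xiA] e0 K0 xie betaK.
apply: norm_le_eval => [|x g]; first by rewrite mulr_ge0.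
rewrite (eval_avg _ _ _ xiA) (le_trans (ler_norm_sum _ _ _))//.
have xiAe : \sum_(h <- A) `|xi h g| <= e.
  rewrite -lee_fin -esum_fsetE//.
  apply: le_trans (le_trans (normu_point xi g) xie).
  rewrite [leRHS](esumID [set` A])// setTI leeDl//.
  by apply: esum_ge0.
rewrite -mulrA (le_trans _ (ler_wpM2r _ xiAe)) ?mulr_ge0//.
rewrite mulr_suml ler_sum// => h _; rewrite normrM ler_wpM2l//.
by rewrite (le_trans (eval_at_le _ _ _))// ler_wpM2r.
Qed.

Context (Phi : G -> blin X X).

HB.instance Definition _ g :=
  GRing.isLinear.Build R L L *:%R (hopf_act Phi g) (@hopf_act_linear R G X Phi g).

Lemma avg_hopf (E : hopfModule Phi) xi beta : finsupp xi ->
  (forall h, hopf_set E (beta h)) -> hopf_set E (avg xi beta).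
Proof.
move=> /finsuppE[A xiA] Ebeta; rewrite (avg_fset _ xiA).
elim/big_ind: _ => [|T U ET EU|h _]; first exact: hopf_0.
  by rewrite -[T]scale1r; exact: hopf_lin.
exact: hopf_C.
Qed.

Lemma eval_hopf_act g (T : L) x h :
  eval_at x h (hopf_act Phi g T) = eval_at (Phi g^-1%g x) (g^-1 * h)%g T.
Proof. by []. Qed.

Lemma hopf_act_mul g (a : C) (T : L) :
  hopf_act Phi g (hopf_mul a T) = hopf_mul (ellinf_act g a) (hopf_act Phi g T).
Proof. by apply: eval_at_ext. Qed.

Lemma hopf_act_avg g xi beta : finsupp xi ->
  hopf_act Phi g (avg xi beta) =
  avg (ellu_act g xi) (fun h => hopf_act Phi g (beta (g^-1 * h)%g)).
Proof.
move=> /finsuppE[A xiA]; rewrite {2}/avg (reindex_fsbigT _ _ (mulg_bij g)).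
under eq_fsbigr do rewrite /ellu_act mulKg -hopf_act_mul.
rewrite (avg_fset _ xiA) raddf_sum/= (fsbigTE A)// => h /xiA ->.
rewrite (_ : hopf_mul 0 _ = 0) ?raddf0//.
by apply: eval_at_ext => x l; exact: mul0r.
Qed.

Context (Phi_mod : bounded_gmodule Phi).

Lemma hopf_act1 (T : L) : hopf_act Phi 1%g T = T.
Proof.
case: Phi_mod => Phi1 _ _; apply: eval_at_ext => x h.
by rewrite /eval_at/= invg1 Phi1 mul1g.
Qed.

Lemma hopf_actM g h (T : L) :
  hopf_act Phi (g * h)%g T = hopf_act Phi g (hopf_act Phi h T).
Proof.
case: Phi_mod => _ PhiM _; apply: eval_at_ext => x k.
by rewrite /eval_at/= invgM PhiM mulgA.
Qed.

Lemma norm_hopf_act_le : exists2 M : R, 0 <= M &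
  forall g (T : L), `|hopf_act Phi g T| <= M * `|T|.
Proof.
case: Phi_mod => _ _ [M PhiM].
have M0 : 0 <= M := le_trans (normr_ge0 _) (PhiM 1%g).
exists M => // g T; apply: norm_le_eval => [|x h]; first by rewrite mulr_ge0.
apply: le_trans (eval_at_le T (Phi g^-1%g x) (g^-1 * h)%g) _.
rewrite (mulrC M) -mulrA ler_wpM2l//.
by apply: le_trans (opnormP _ _) _; rewrite ler_wpM2r// PhiM.
Qed.

Definition fcons n (a : G) (v : 'I_n -> G) : 'I_n.+1 -> G :=
  fun j => if unlift ord0 j is Some i then v i else a.

Lemma fcons0 n a (v : 'I_n -> G) : fcons a v ord0 = a.
Proof. by rewrite /fcons unlift_none. Qed.

Lemma fconsS n a (v : 'I_n -> G) i : fcons a v (lift ord0 i) = v i.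
Proof. by rewrite /fcons liftK. Qed.

Lemma merge_fcons0 n a (v : 'I_n.+1 -> G) :
  Defs.merge ord0 (fcons a v) = fcons (a * v ord0)%g (fun j => v (lift ord0 j)).
Proof.
apply/funext => j; case: (unliftP ord0 j) => [i ->|->];
  rewrite /Defs.merge ?fconsS ?fcons0//=.
rewrite (_ : widen_ord _ _ = ord0) ?fcons0//.
exact: val_inj.
Qed.

Lemma merge_fconsS n a (v : 'I_n.+1 -> G) (i : 'I_n) :
  Defs.merge (lift ord0 i) (fcons a v) = fcons a (Defs.merge i v).
Proof.
have widenS m (j : 'I_m) : widen_ord (leqnSn m.+1) (lift ord0 j) =
    lift ord0 (widen_ord (leqnSn m) j) by exact: val_inj.
apply/funext => j; case: (unliftP ord0 j) => [k ->|->].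
  by rewrite /Defs.merge !widenS !fconsS !lift0 ltnS (inj_eq lift_inj).
rewrite fcons0 /Defs.merge /= (_ : widen_ord _ _ = ord0) ?fcons0//.
exact: val_inj.
Qed.

Lemma widen_fcons n a (v : 'I_n.+1 -> G) :
  (fun j => fcons a v (widen_ord (leqnSn n.+1) j)) =
  fcons a (fun j => v (widen_ord (leqnSn n) j)).
Proof.
apply/funext => j; case: (unliftP ord0 j) => [k ->|->].
  rewrite (_ : widen_ord _ _ = lift ord0 (widen_ord (leqnSn n) k)) ?fconsS//.
  exact: val_inj.
by rewrite (_ : widen_ord _ _ = ord0) ?fcons0//; exact: val_inj.
Qed.

(* In homogeneous coordinates [b (h^-1, g_1, ..)] translated by [h] is
   [B (h, 1, g_1, g_1 g_2, ..)], so this averages the standard contraction. *)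
Definition avg_cochain n xi (b : ('I_n.+1 -> G) -> L) (v : 'I_n -> G) : L :=
  avg xi (fun h => hopf_act Phi h (b (fcons h^-1%g v))).

Lemma cdiff_avg_cochain n xi (b : ('I_n.+1 -> G) -> L) (v : 'I_n.+1 -> G) :
  finsupp xi -> \sum_(g \in [set: G]) xi g = ellinf_cst G 1 ->
  cdiff Phi b = 0 ->
  b v - cdiff Phi (avg_cochain xi b) v =
  avg (xi - ellu_act (v ord0) xi)
    (fun h => hopf_act Phi h
      (b (fcons (h^-1 * v ord0)%g (fun j => v (lift ord0 j))))).
Proof.
move=> xifin xi1 b0.
have bv h : b v =
    hopf_act Phi h (b (fcons (h^-1 * v ord0)%g (fun j => v (lift ord0 j))))
    + \sum_(i < n) (-1) ^+ i.+1 *: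
        hopf_act Phi h (b (fcons h^-1%g (Defs.merge i v)))
    + (-1) ^+ n.+1 *: hopf_act Phi h
        (b (fcons h^-1%g (fun j => v (widen_ord (leqnSn n) j)))).
  have := congr1 (fun c => hopf_act Phi h (c (fcons h^-1%g v))) b0.
  rewrite /= /cdiff big_ord_recl merge_fcons0 fcons0 widen_fcons.
  rewrite (_ : (fun j => fcons _ v (lift ord0 j)) = v); last first.
    by apply/funext => j; rewrite fconsS.
  rewrite -[X in _ = hopf_act _ _ X]/(0 : L) raddf0.
  rewrite !raddfD/= -hopf_actM mulgV hopf_act1.
  rewrite raddf_sum !linearZ/= expr1 scaleN1r exprS mulN1r scaleNr.
  move=> /eqP; rewrite -!addrA addr_eq0 => /eqP ->.
  rewrite !opprD !opprK; congr (_ + (_ + _)).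
  rewrite -sumrN; apply: eq_bigr => i _.
  by rewrite merge_fconsS linearZ/= /bump leq0n add1n exprS mulN1r scaleNr opprK.
have {}bv : b v = avg xi (fun h => hopf_act Phi h
      (b (fcons (h^-1 * v ord0)%g (fun j => v (lift ord0 j)))))
    + \sum_(i < n) (-1) ^+ i.+1 *: avg_cochain xi b (Defs.merge i v)
    + (-1) ^+ n.+1 *: avg_cochain xi b (fun j => v (widen_ord (leqnSn n) j)).
  rewrite -[LHS](avg_cst (b v) xifin xi1) (funext bv) !avgDr// avg_sumr//.
  rewrite avgZr//; congr (_ + _ + _).
  by apply: eq_bigr => i _; rewrite avgZr.
rewrite {1}bv /cdiff avgBl//; last exact: finsupp_act.
have cancel (p q s t : L) : p + s + t - (q + s + t) = p - q.
  by rewrite opprD addrACA subrr addr0 opprD addrACA subrr addr0.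
rewrite cancel hopf_act_avg//; congr (_ - avg _ _); apply/funext => h.
by rewrite -hopf_actM mulVKg invgM invgK.
Qed.

End Averages.

Lemma cdiff_eval_cvg (R : realType) (G : groupType) (X : completeNormedModType R)
    (Phi : G -> blin X X) (I : Type) (F : set_system I) {FF : Filter F} (n : nat)
    (c_ : I -> ('I_n -> G) -> blin X (ellinf R G))
    (c : ('I_n -> G) -> blin X (ellinf R G)) :
  (forall v x h, eval_at x h (c_ i v) @[i --> F] --> eval_at x h (c v)) ->
  forall v x h,
    eval_at x h (cdiff Phi (c_ i) v) @[i --> F] --> eval_at x h (cdiff Phi c v).
Proof.
move=> c_c v x h.
have cdiffE d : eval_at x h (cdiff Phi d v) =
    eval_at (Phi (v ord0)^-1%g x) ((v ord0)^-1 * h)%g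
      (d (fun j => v (lift ord0 j)))
    + \sum_(i < n) (-1) ^+ i.+1 * eval_at x h (d (Defs.merge i v))
    + (-1) ^+ n.+1 * eval_at x h (d (fun j => v (widen_ord (leqnSn n) j))).
  by rewrite /cdiff 2!raddfD /= eval_at_sumZ eval_atZ eval_hopf_act.
rewrite cdiffE; under eq_fun do rewrite cdiffE.
apply: cvgD; last by apply: cvgMl_tmp; exact: c_c.
apply: cvgD; first exact: c_c.
apply: cvg_big => [|i _]; first exact: add_continuous.
by apply: cvgMl_tmp; exact: c_c.
Qed.

Theorem proposition5p1 (R : realType) (G : groupType) (S : seq G)
  (S_sym : forall s, s \in S -> (s^-1)%g \in S)
  (S_gen : generates S)
  (G_exact : exact_group R S)
  (n : nat) (n_ge1 : (1 <= n)%N)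
  (X : completeNormedModType R) (Phi : G -> blin X X)
  (Phi_mod : bounded_gmodule Phi)
  (E : hopfModule Phi) (E_closed : weak_star_closed E) :
  forall a : Hb E n, a = 0.
Proof.
case: n n_ge1 => [//|n] _; elim/quotW => b; apply/eqP.
have <- : (\pi_(Hb E n.+1) 0)%qT = 0 by rewrite piE.
rewrite -Quotient.idealrBE subr0.
apply/coboundary_predP; have /cocycle_predP[[Eb [K bK]] db0] := valP b.
have [xi [xifin xi0 xi1 xi_inv]] := exact_asymptotic_invariance S_gen G_exact.
have [M M0 actM] := norm_hopf_act_le Phi_mod.
have K0 : 0 <= K := le_trans (normr_ge0 _) (bK (fun=> 1%g)).
have actbK h v : `|hopf_act Phi h (b v)| <= M * K.
  by apply: le_trans (actM _ _) _; apply: ler_wpM2l => //; exact: bK.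
pose c_ k := avg_cochain Phi (xi k) b.
have c_le k v : `|c_ k v| <= M * K.
  rewrite -[leRHS]mul1r; apply: norm_avg_le; rewrite ?mulr_ge0//.
  by apply: normu_prob => //; exact: xi0.
have [U [UU oo_U]] := @ultraFilterLemma nat \oo _.
have /choice[c c_cvg] v : exists T : blin X (ellinf R G), `|T| <= M * K /\
    forall x h, eval_at x h (c_ k v) @[k --> U] --> eval_at x h T.
  have [T] := weak_star_ultra_limit (fun k => c_le k v).
  by exists T.
exists c.
  split=> [v|]; last by exists (M * K) => v; case: (c_cvg v).
  have c_weak : c_ ^~ v @ U --> (c v : weak_star G X).
    exact: weak_star_cvg (c_le ^~ v) (c_cvg v).2.
  apply: (@closed_cvg _ (weak_star G X) U _ (c_ ^~ v) _ E_closed _ _ c_weak).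
  by apply: nearW => k; apply: avg_hopf => // h; apply: hopf_G; exact: Eb.
apply/funext => v; apply: eval_at_ext => x h.
have dc : eval_at x h (cdiff Phi (c_ k) v) @[k --> U]
    --> eval_at x h (cdiff Phi c v).
  by apply: cdiff_eval_cvg => w; exact: (c_cvg w).2.
apply: cvg_unique dc _ => //.
apply/cvgrPdist_le => e e0.
pose N := M * K * `|x| + 1.
have N0 : 0 < N by rewrite ltr_wpDl// !mulr_ge0.
have := xi_inv (v ord0) (e / N) (divr_gt0 e0 N0).
move=> /oo_U; apply: filterS => k xik.
rewrite -raddfB/= cdiff_avg_cochain// (le_trans (eval_at_le _ _ _))//.
have avgle : `|avg (xi k - ellu_act (v ord0) (xi k)) (fun h0 => hopf_act Phi h0
  (b (fcons (h0^-1 * v ord0)%g (fun j => v (lift ord0 j)))))| <= e / N * (M * K).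
  apply: norm_avg_le => //.
  - by apply: finsuppB => //; exact: finsupp_act.
  - by rewrite divr_ge0 ?ltW.
  - exact: mulr_ge0.
apply: le_trans (ler_wpM2r (normr_ge0 x) avgle) _.
have -> : e / N * (M * K) * `|x| = e * (M * K * `|x| / N) by ring.
by rewrite ler_piMr ?(ltW e0)// ler_pdivrMr// mul1r lerDl.
Qed.
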